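(* Let $(\mathcal{H},d)$ be a Hadamard space, and let $f:\mathcal{H}\to(-\infty,\infty]$ and $f^n:\mathcal{H}\to(-\infty,\infty]$, $n\in\mathbb{N}$, be proper lower semicontinuous convex functions. Let $J_\lambda$ and $J^n_\lambda$, $\lambda>0$, be the resolvents of $f$ and $f^n$, and let $(S_t)_{t>0}$ and $(S^n_t)_{t>0}$ be the gradient flow semigroups of $f$ and $f^n$, respectively. Assume that $$\lim_{n\to\infty}J^n_\lambda x=J_\lambda x\qquad\text{for every }x\in\overline{\operatorname{dom}}\,f\text{ and every }\lambda>0.$$ Then $$\lim_{n\to\infty}S^n_t x=S_t x$$ for every $x\in\overline{\operatorname{dom}}\,f$ and every $t>0$.
   Context: A Hadamard space is a complete geodesic metric space $(\mathcal{H},d)$ such that $d(x,\gamma(t))^2\le(1-t)d(x,\gamma(0))^2+t\,d(x,\gamma(1))^2-t(1-t)d(\gamma(0),\gamma(1))^2$ for every $x\in\mathcal{H}$, every (constant-speed) geodesic $\gamma:[0,1]\to\mathcal{H}$ and every $t\in[0,1]$. A function $f:\mathcal{H}\to(-\infty,\infty]$ is convex if $f\circ\gamma$ is convex for every geodesic $\gamma:[0,1]\to\mathcal{H}$; it is proper if it is not identically $\infty$. Write $\operatorname{dom}f=\{x\in\mathcal{H}:f(x)<\infty\}$ and $\overline{\operatorname{dom}}\,f$ for its closure. For a proper convex lower semicontinuous $f$ and $\lambda>0$, the resolvent is $J_\lambda(x)=\arg\min_{y\in\mathcal{H}}\left[f(y)+\frac1{2\lambda}d(x,y)^2\right]$,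 $x\in\mathcal{H}$ (the minimizer exists and is unique). The gradient flow semigroup of $f$ is $S_t(x)=\lim_{k\to\infty}\left(J_{t/k}\right)^{(k)}(x)$ for $x\in\overline{\operatorname{dom}}\,f$, where $F^{(k)}$ denotes the $k$-fold composition of a map $F$ with itself; this limit exists, and each $S_t$ is nonexpansive. The resolvents $J^n_\lambda$ and semigroups $S^n_t$ are defined in the same way from $f^n$. *)

(* Defs.v *)
From HB Require Import structures.
From mathcomp Require Import all_boot all_order all_algebra.
From mathcomp Require Import all_classical all_reals.
From mathcomp Require Import ereal topology normedtype.

Set Implicit Arguments.
Unset Strict Implicit.
Unset Printing Implicit Defensive.

Import Order.TTheory GRing.Theory Num.Theory.
Import numFieldNormedType.Exports.

Local Open Scope classical_set_scope.
Local Open Scope ring_scope.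

(* A path [0,1] -> H is represented by a function on R, whose values outside
   [0,1] are irrelevant. *)
Definition geodesic (R : realType) (H : metricType R) (g : R -> H) : Prop :=
  forall s t : R, 0 <= s <= 1 -> 0 <= t <= 1 ->
    mdist (g s) (g t) = `|s - t| * mdist (g 0) (g 1).

(* The axiom of [completeType], which cannot be used here as such because it
   requires a distinguished point. *)
Definition complete_space (R : realType) (H : metricType R) : Prop :=
  forall F : set_system H, ProperFilter F -> cauchy F -> exists l : H, F --> l.

Definition geodesic_space (R : realType) (H : metricType R) : Prop :=
  forall x y : H, exists2 g : R -> H, geodesic g & g 0 = x /\ g 1 = y.

Definition hadamard_space (R : realType) (H : metricType R) : Prop :=
  [/\ complete_space H,
      geodesic_space H &
      forall (x : H) (g : R -> H) (t : R), geodesic g -> 0 <= t <= 1 ->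
        mdist x (g t) ^+ 2 <=
          (1 - t) * mdist x (g 0) ^+ 2 + t * mdist x (g 1) ^+ 2
          - t * (1 - t) * mdist (g 0) (g 1) ^+ 2].

(* Only used for h with values in (-oo, +oo], so the sum is never of the form
   (+oo) + (-oo); 0 * (+oo) is 0. *)
Definition convex01 (R : realType) (h : R -> \bar R) : Prop :=
  forall r s t : R, 0 <= r <= 1 -> 0 <= s <= 1 -> 0 <= t <= 1 ->
    (h ((1 - t) * r + t * s)%R <= (1 - t)%:E * h r + t%:E * h s)%E.

Definition geodesically_convex (R : realType) (H : metricType R)
    (f : H -> \bar R) : Prop :=
  forall g : R -> H, geodesic g -> convex01 (f \o g).

(* This includes the requirement that f takes its values in (-oo, +oo]. *)
Definition proper_fun (R : realType) (H : metricType R)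
    (f : H -> \bar R) : Prop :=
  (forall x, f x != -oo%E) /\ exists x, f x != +oo%E.

Definition edom (R : realType) (H : metricType R) (f : H -> \bar R) : set H :=
  [set x | (f x < +oo)%E].

Definition argmin (R : realType) (H : metricType R) (g : H -> \bar R) : set H :=
  [set y | forall z, (g y <= g z)%E].

(* The default value x is never used on a Hadamard space with f proper, convex
   and lower semicontinuous and 0 < lam: there is then exactly one minimizer. *)
Definition resolvent (R : realType) (H : metricType R) (f : H -> \bar R)
    (lam : R) (x : H) : H :=
  xget x (argmin (fun y => f y + ((2 * lam)^-1 * mdist x y ^+ 2)%:E)%E).

(* The limit (unique, as a metric space is Hausdorff) of the k-fold iterates
   of the resolvent of parameter t / k. The formula is used at every x, not
   only in the closure of edom f: the limit also exists elsewhere, and is then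
   the value of the semigroup at the projection of x on the closure of edom f. *)
Definition gradient_flow (R : realType) (H : metricType R) (f : H -> \bar R)
    (t : R) (x : H) : H :=
  xget x [set l | iter k (resolvent f (t / k%:R)) x @[k --> \oo] --> l].

(* Main.v *)
(* Nonexpansiveness and the resolvent identity give the recursion
     d(J_lam^m y, J_mu^n y)^2 <=
       (1 - mu/lam) d(J_lam^m y, J_mu^(n-1) y)^2
       + (mu/lam) d(J_lam^(m-1) y, J_mu^(n-1) y)^2      (mu <= lam),
   whose solution (Crandall-Liggett, Kobayashi) is a rate of convergence of
   J_{t/k}^k y to S_t y that depends on f only through a bound on
   d(y, J_s y) / s. For y = J_lam x this quantity is at most d(x, J_lam x) / lam,
   which is bounded uniformly in n when J is replaced by J^n. Hence S^n_t x is
   approximated, uniformly in n, by the k-fold iterate of J^n_{t/k} at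
   J^n_lam x, and for fixed k these iterates converge by nonexpansiveness. *)

Require Import Defs.
From mathcomp Require Import all_boot all_order all_algebra.
From mathcomp Require Import all_classical all_reals.
From mathcomp Require Import ereal topology normedtype.
From mathcomp Require Import ring lra.

Set Implicit Arguments.
Unset Strict Implicit.
Unset Printing Implicit Defensive.

Import Order.TTheory GRing.Theory Num.Theory.
Import numFieldNormedType.Exports.

Local Open Scope classical_set_scope.
Local Open Scope ring_scope.

Lemma sqr_lower_bound (R : realType) (a b e : R) :
  0 <= a -> 0 <= b -> 0 <= e -> b - e <= a -> b ^+ 2 - 2 * b * e <= a ^+ 2.
Proof.
move=> a0 b0 e0 h; have [be|be] := lerP e b; nra.
Qed.

(** * Comparison inequalities in Hadamard spaces *)

Section hadamard_geometry.
Context (R : realType) (H : metricType R) (hadH : hadamard_space H).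
Local Notation d := (@mdist R H).

Lemma geodesic_point (a b : H) (t : R) : 0 <= t <= 1 ->
  exists p, [/\ d a p = t * d a b, d p b = (1 - t) * d a b,
    forall x, d x p ^+ 2 <=
      (1 - t) * d x a ^+ 2 + t * d x b ^+ 2 - t * (1 - t) * d a b ^+ 2
  & forall f : H -> \bar R, geodesically_convex f ->
      (f p <= (1 - t)%:E * f a + t%:E * f b)%E].
Proof.
case: hadH => _ geoH cat0 t01; have [g gg [g0 g1]] := geoH a b.
have z01 : 0 <= (0 : R) <= 1 by rewrite lexx ler01.
have o01 : 0 <= (1 : R) <= 1 by rewrite lexx ler01.
have t01' := t01; move: t01' => /andP[t0 t1].
exists (g t); split.
- by rewrite -{1}g0 gg// g0 g1 sub0r normrN ger0_norm.
- by rewrite -{1}g1 gg// g0 g1 distrC ger0_norm// subr_ge0.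
- by move=> x; have := cat0 x g t gg t01; rewrite g0 g1.
- move=> f fc; have := fc g gg 0 1 t z01 o01 t01.
  by rewrite mulr0 add0r mulr1 /= g0 g1.
Qed.

(* Apply the comparison inequality at the point of the diagonal [x, v] that
   divides it in the ratio d x y : d u v. *)
Lemma quadrilateral_ineq (x y u v : H) :
  d x v ^+ 2 + d y u ^+ 2 <=
  d x u ^+ 2 + d y v ^+ 2 + 2 * d x y * d u v.
Proof.
have [->|xy] := eqVneq x y.
  by rewrite mdistxx mulr0 mul0r addr0 addrC.
have [->|uv] := eqVneq u v.
  by rewrite mdistxx mulr0 addr0.
move: xy uv; rewrite -!mdist_gt0 => xy uv.
set A := d x y in xy *; set B := d u v in uv *.
have AB0 : 0 < A + B by rewrite addr_gt0.
set t := A / (A + B).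
have tA : t * (A + B) = A by rewrite /t divfK// gt_eqF.
have t0 : 0 < t by rewrite divr_gt0.
have t1 : t < 1 by rewrite /t ltr_pdivrMr// mul1r ltrDl.
have [|p [_ _ Hp _]] := @geodesic_point x v t; first by rewrite !ltW.
have := Hp y; have := Hp u; have := metric_triangle y p u.
rewrite -/A (metric_sym y x) -/A -/B (metric_sym u x) (metric_sym u p).
have := mdist_ge0 y p; have := mdist_ge0 p u; have := mdist_ge0 y u.
move: (d y p) (d p u) (d y u) (d x u) (d x v) (d y v).
move=> a b yu xu xv yv yu0 b0 a0 tri h1 h2.
(* This choice of [t] turns [(1 - t)^2 A^2 + t^2 B^2] into the cross term [2 t (1 - t) A B]. *)
have tB : (1 - t) * A = t * B by lra.
(* With [a + b] in place of [yu], the two sides differ by the square of [(1 - t) a - t b]. *)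
have sq : t * (1 - t) * yu ^+ 2 <= (1 - t) * a ^+ 2 + t * b ^+ 2.
  have s1 : yu ^+ 2 <= (a + b) ^+ 2 by rewrite lerXn2r// nnegrE addr_ge0.
  have tt : 0 <= t * (1 - t) by rewrite mulr_ge0// ltW// subr_gt0.
  have := ler_wpM2l tt s1.
  have := sqr_ge0 ((1 - t) * a - t * b).
  lra.
suff : t * (1 - t) * (xv ^+ 2 + yu ^+ 2) <=
       t * (1 - t) * (xu ^+ 2 + yv ^+ 2 + 2 * A * B).
  by rewrite ler_pM2l// mulr_gt0// subr_gt0.
have tn0 : 0 <= t by exact: ltW. have tn1 : 0 <= 1 - t by rewrite ltW// subr_gt0.
have := ler_wpM2l tn1 h2; have := ler_wpM2l tn0 h1.
have e1 : (1 - t) * ((1 - t) * A ^+ 2) = (1 - t) * t * A * B.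
  by rewrite expr2 [_ * (A * A)]mulrA tB; ring.
have e2 : t * (t * B ^+ 2) = (1 - t) * t * A * B.
  by rewrite expr2 [_ * (B * B)]mulrA -tB; ring.
lra.
Qed.

End hadamard_geometry.

(** * Existence and variational inequality of the resolvent *)

Section resolvent_existence.
Context (R : realType) (H : metricType R) (hadH : hadamard_space H).
Context (f : H -> \bar R) (f_proper : proper_fun f).
Context (f_lsc : lower_semicontinuous f) (f_convex : geodesically_convex f).
Local Notation d := (@mdist R H).
Local Notation phi := (fun x => fine (f x)).

Lemma edomE x : edom f x -> f x = (phi x)%:E.
Proof.
move=> fx; rewrite fineK// fin_numE (proj1 f_proper)/=.
by move: fx; rewrite /edom/= lt_neqAle => /andP[].
Qed.

Lemma edom_geodesic_point (a b : H) (t : R) :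
  edom f a -> edom f b -> 0 <= t <= 1 ->
  exists p, [/\ edom f p, d a p = t * d a b,
    forall x, d x p ^+ 2 <=
      (1 - t) * d x a ^+ 2 + t * d x b ^+ 2 - t * (1 - t) * d a b ^+ 2
  & phi p <= (1 - t) * phi a + t * phi b].
Proof.
move=> fa fb t01; have [p [ap _ pc /(_ f f_convex)]] := geodesic_point hadH a b t01.
rewrite (edomE fa) (edomE fb) -!EFinM -EFinD => fp.
have dp : edom f p by rewrite /edom/= (le_lt_trans fp)// ltry.
by exists p; split=> //; move: fp; rewrite {1}(edomE dp) lee_fin.
Qed.

(* Lower semicontinuity bounds f from below near a point x0 of its domain;
   convexity along geodesics issued from x0 extends this to a bound that is
   affine in the distance. *)
Lemma affine_minorant (x : H) :
  exists a b, 0 <= b /\ forall y, edom f y -> a - b * d x y <= phi y.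
Proof.
case: f_proper => _ [x0 fx0].
have dx0 : edom f x0 by rewrite /edom/= ltey.
have [|V Vx0 fV] := @f_lsc x0 (phi x0 - 1).
  by rewrite {2}(edomE dx0) lte_fin ltrBlDr ltrDl.
move/metricType_numDomainType.nbhs_mdistP : Vx0 => [e /= e0 eV].
set r := e / 2; have r0 : 0 < r by rewrite divr_gt0.
have re : r < e by rewrite /r ltr_pdivrMr// ltr_pMr// ltrDl.
have near y : edom f y -> d x0 y <= r -> phi x0 - 1 <= phi y.
  move=> dy yr; have := fV y (eV y (le_lt_trans yr re)).
  by rewrite {1}(edomE dy) lte_fin => /ltW.
have rV0 : 0 < r^-1 by rewrite invr_gt0.
suff main y : edom f y -> phi x0 - 1 - r^-1 * d x0 y <= phi y.
  exists (phi x0 - 1 - r^-1 * d x0 x), r^-1; split; first exact: ltW.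
  move=> y dy; apply: le_trans (main y dy).
  by have := ler_wpM2l (ltW rV0) (metric_triangle x0 x y); lra.
move=> dy; have [yr|yr] := lerP (d x0 y) r.
  apply: le_trans (near y dy yr); rewrite lerBlDr lerDl.
  by rewrite mulr_ge0 ?mdist_ge0// ltW.
have D0 := lt_trans r0 yr.
(* The point at ratio [t] from [x0] to [y] is at distance exactly [r] from [x0], so that [near]
   applies to it. *)
set t := r / d x0 y.
have t0 : 0 < t by rewrite divr_gt0.
have t01 : 0 <= t <= 1 by rewrite ltW//= /t ler_pdivrMr// mul1r ltW.
have tD : t * d x0 y = r by rewrite /t divfK// gt_eqF.
have [p [dp px0 _ pc]] := edom_geodesic_point dx0 dy t01.
have := near p dp; rewrite px0 tD => /(_ (lexx _)) h.
have e1 : t * (r^-1 * d x0 y) = 1 by rewrite mulrCA tD mulVf// gt_eqF.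
rewrite -(ler_pM2l t0); lra.
Qed.

Variables (lam : R) (x : H).
Hypothesis lam0 : 0 < lam.
Let c := (2 * lam)^-1.
Let c0 : 0 < c. Proof. by rewrite invr_gt0 mulr_gt0. Qed.
Let G y := phi y + c * d x y ^+ 2.
Let V := [set G y | y in edom f].

Let V_has_inf : has_inf V.
Proof.
case: f_proper => _ [x0 fx0].
have dx0 : edom f x0 by rewrite /edom/= ltey.
split; first by exists (G x0), x0.
have [a [b [b0 ab]]] := affine_minorant x.
(* This is the minimum of [a - b D + c D^2] over real [D]. *)
exists (a - b ^+ 2 / (4 * c)) => _ [y dy <-]; rewrite /G.
have := ab y dy; set D := d x y => h.
have bc : b ^+ 2 / (4 * c) * c = b ^+ 2 / 4 by rewrite invfM mulrA divfK// gt_eqF.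
have := sqr_ge0 (b / 2 - c * D).
move=> h2; rewrite -(ler_pM2l c0); have := ler_wpM2l (ltW c0) h.
lra.
Qed.

Let I := inf V.

Let I_le y : edom f y -> I <= G y.
Proof. by move=> dy; apply: ge_inf; [case: V_has_inf | exists y]. Qed.

Let sublevel (e : R) : set H := [set y | edom f y /\ G y < I + e].

(** At the midpoint, [G] is at least [I], but also at most the mean of [G y] and [G z] minus
    [c d(y,z)^2 / 4]. *)
Let sublevel_diam e y z : sublevel e y -> sublevel e z ->
  c * d y z ^+ 2 <= 4 * e.
Proof.
move=> [dy Gy] [dz Gz].
have h01 : 0 <= (2^-1 : R) <= 1 by rewrite invr_ge0 ler0n invf_le1// ler1n.
have [p [dp _ /(_ x) xp pp]] := edom_geodesic_point dy dz h01.
have := I_le dp; move: Gy Gz; rewrite /G.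
have := ler_wpM2l (ltW c0) xp; lra.
Qed.

(** This filter stands in for a minimizing sequence; [sublevel_diam] makes it Cauchy. *)
Let minimizing := filter_from [set e : R | 0 < e] sublevel.

Let minimizing_proper : ProperFilter minimizing.
Proof.
apply: filter_from_proper.
  apply: filter_from_filter; first by exists 1 => /=.
  move=> i j /= i0 j0; exists (Num.min i j); first by rewrite /= lt_min i0.
  move=> y [dy yI]; split; split=> //; apply: (lt_le_trans yI);
    by rewrite lerD2l ge_min lexx// orbT.
by move=> e /= e0; have [_ [y dy <-] ye] := inf_adherent e0 V_has_inf; exists y.
Qed.

Let minimizing_cauchy : cauchy minimizing.
Proof.
have mP := minimizing_proper; apply: cauchy_exP => e e0.
set h := c * e ^+ 2 / 8.
have h0 : 0 < h by rewrite divr_gt0// mulr_gt0// exprn_gt0.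
have [_ [y dy <-] yh] := inf_adherent h0 V_has_inf.
exists y, h => // z zh; rewrite ballEmdist/=.
have yh' : sublevel h y by [].
have := sublevel_diam yh' zh => {}yz.
rewrite -(@ltr_pXn2r _ 2)// ?nnegrE ?mdist_ge0// ?ltW//.
rewrite -(ltr_pM2l c0) (le_lt_trans yz)// /h.
have ce0 : 0 < c * e ^+ 2 by rewrite mulr_gt0// exprn_gt0.
lra.
Qed.

(** By lower semicontinuity, the limit of the filter [minimizing] attains the infimum [I]. *)
Lemma argmin_exists :
  exists y, argmin (fun y => f y + (c * d x y ^+ 2)%:E)%E y.
Proof.
case: hadH => complH _ _.
have [l Fl] := complH _ minimizing_proper minimizing_cauchy.
have mP := minimizing_proper; have lsc_l a : (a%:E < f l)%E -> a <= I - c * d x l ^+ 2.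
  move=> al; have [W Wl fW] := f_lsc al.
  rewrite leNgt; apply/negP => h.
  set K := d x l in h.
  have K0 : 0 <= K by exact: mdist_ge0.
  set eta := a - (I - c * K ^+ 2).
  have eta0 : 0 < eta by rewrite subr_gt0.
  have q0 : 0 < 1 + 2 * c * K by rewrite ltr_wpDr// !mulr_ge0// ltW.
  (* Moving by [e] away from [l] lowers the quadratic term by at most [2 c K e], and [sublevel e]
     allows a further [e]; together they make up exactly [eta]. *)
  set e := eta / (1 + 2 * c * K).
  have e0 : 0 < e by rewrite divr_gt0.
  have eq : e * (1 + 2 * c * K) = eta by rewrite /e divfK// gt_eqF.
  have B : minimizing (ball l e) by apply: Fl; exact: nbhsx_ballx.
  have S : minimizing (sublevel e) by exists e.
  have [y [[Wy yl] [dy Gy]]] := filter_ex (filterI (filterI (Fl _ Wl) B) S).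
  have := fW y Wy; rewrite {1}(edomE dy) lte_fin => ay.
  move: yl; rewrite ballEmdist/= => yl.
  have tri := metric_triangle x y l.
  have Ke : K - e <= d x y.
    by rewrite lerBlDr (le_trans tri)// lerD2l metric_sym ltW.
  have sq := sqr_lower_bound (mdist_ge0 x y) K0 (ltW e0) Ke.
  have := ler_wpM2l (ltW c0) sq; move: Gy; rewrite /G; move: eq; rewrite /eta.
  lra.
have fl : (f l <= (I - c * d x l ^+ 2)%:E)%E.
  rewrite leNgt; apply/negP => h.
  have [dl|] := boolP (f l < +oo)%E.
    move: h lsc_l; rewrite (edomE dl) lte_fin => h /(_ ((I - c * d x l ^+ 2 + phi l) / 2)).
    by rewrite lte_fin; lra.
  rewrite -leNgt leye_eq => /eqP fly.
  by have := lsc_l (I - c * d x l ^+ 2 + 1); rewrite fly ltry => /(_ isT); lra.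
have dl : edom f l by rewrite /edom/= (le_lt_trans fl)// ltry.
exists l => z.
have [dz|] := boolP (f z < +oo)%E; last first.
  rewrite -leNgt leye_eq => /eqP ->.
  by rewrite addye// leey.
rewrite (edomE dl) (edomE dz) -!EFinD lee_fin.
apply: le_trans (I_le dz); move: fl; rewrite (edomE dl) lee_fin; lra.
Qed.

(* The variational characterization of the resolvent, multiplied by 2 lam. *)
Lemma resolvent_variational : edom f (resolvent f lam x) /\
  forall z, edom f z ->
    2 * lam * (phi (resolvent f lam x) - phi z) + d x (resolvent f lam x) ^+ 2
      + d (resolvent f lam x) z ^+ 2 <= d x z ^+ 2.
Proof.
have := xgetPex x argmin_exists; rewrite -/(resolvent f lam x).
set y := resolvent f lam x => miny.
have dy : edom f y.
  case: f_proper => _ [x0 fx0].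
  have dx0 : edom f x0 by rewrite /edom/= ltey.
  have := miny x0; rewrite (edomE dx0) -EFinD => h.
  rewrite /edom/= ltey; apply/negP => /eqP fy.
  by move: h; rewrite fy addye// leye_eq.
split=> // z dz.
(* Minimality of [y] is tested at the point of ratio [t] from [y] to [z] and divided by [t];
   afterwards [t] tends to 0. *)
have step t : 0 < t -> t <= 1 ->
    2 * lam * (phi y - phi z) + d x y ^+ 2 + (1 - t) * d y z ^+ 2 <= d x z ^+ 2.
  move=> t0 t1; have t01 : 0 <= t <= 1 by rewrite ltW.
  have [p [dp _ /(_ x) xp pp]] := edom_geodesic_point dy dz t01.
  have := miny p; rewrite (edomE dy) (edomE dp) -!EFinD lee_fin => h.
  have lc : 2 * lam * c = 1 by rewrite /c divff// mulf_neq0// gt_eqF.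
  have l2 : 0 <= 2 * lam by rewrite mulr_ge0// ltW.
  have := ler_wpM2l l2 h; rewrite !mulrDr !(mulrA _ c) lc !mul1r.
  have := ler_wpM2l l2 pp => h1 h2.
  rewrite -(ler_pM2l t0); lra.
apply/ler_addgt0Pl => e e0.
set D := d y z ^+ 2.
have D0 : 0 <= D by rewrite sqr_ge0.
set t := Num.min 1 (e / (D + 1)).
have D1 : 0 < D + 1 by rewrite ltr_wpDl.
have t0 : 0 < t by rewrite lt_min ltr01 divr_gt0.
have t1 : t <= 1 by rewrite ge_min lexx.
have tD : t * D <= e.
  rewrite (@le_trans _ _ (e / (D + 1) * D))//.
    by rewrite ler_wpM2r// ge_min lexx orbT.
  by rewrite mulrAC ler_pdivrMr// ler_pM2l// lerDl.
have := step t t0 t1; rewrite -/D; lra.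
Qed.

End resolvent_existence.

(** * Metric estimates for resolvents and their iterates *)

Section resolvent_theory.
Context (R : realType) (H : metricType R) (hadH : hadamard_space H).
Context (f : H -> \bar R) (f_proper : proper_fun f).
Context (f_lsc : lower_semicontinuous f) (f_convex : geodesically_convex f).
Local Notation d := (@mdist R H).
Local Notation phi := (fun x => fine (f x)).
Local Notation J := (resolvent f).
Implicit Types (x y z : H) (lam mu t : R) (m n k : nat).

Let Jvar := resolvent_variational hadH f_proper f_lsc f_convex.

Lemma edom_resolvent lam x : 0 < lam -> edom f (J lam x).
Proof. by move=> lam0; have [] := Jvar x lam0. Qed.

(** Adding minimality of [y] to the variational inequality of [J lam x] leaves only the squared
    distance between the two points. *)
Lemma resolvent_unique lam x y : 0 < lam -> edom f y ->
  (forall z, edom f z -> 2 * lam * (phi y - phi z) + d x y ^+ 2 <= d x z ^+ 2) ->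
  y = J lam x.
Proof.
move=> lam0 dy miny; have [dJ /(_ y dy) h] := Jvar x lam0.
have := miny _ dJ => h2.
have : d (J lam x) y ^+ 2 <= 0 by lra.
rewrite le_eqVlt ltNge sqr_ge0 orbF sqrf_eq0 => /eqP.
by move/(@mdist_positivity _ H).
Qed.

(** In the sum of the two variational inequalities the values of [f] cancel, and
    [quadrilateral_ineq] bounds the remaining distances. *)
Lemma resolvent_nonexpansive lam x y : 0 < lam -> d (J lam x) (J lam y) <= d x y.
Proof.
move=> lam0; have [-> |ne] := eqVneq (J lam x) (J lam y).
  by rewrite mdistxx mdist_ge0.
have [dx hx] := Jvar x lam0; have [dy hy] := Jvar y lam0.
have := hx _ dy; have := hy _ dx; have := quadrilateral_ineq hadH x y (J lam x) (J lam y).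
move: ne; rewrite -mdist_gt0 (metric_sym (J lam y) (J lam x)).
set D := d (J lam x) (J lam y) => D0 h1 h2 h3.
rewrite -(ler_pM2r D0); lra.
Qed.

Lemma iter_resolvent_nonexpansive lam x y k : 0 < lam ->
  d (iter k (J lam) x) (iter k (J lam) y) <= d x y.
Proof.
move=> lam0; elim: k => //= k; apply: le_trans.
exact: resolvent_nonexpansive.
Qed.

(* By the resolvent identity, J lam x is also J mu z for the point z of the
   segment from J lam x to x at ratio mu / lam. *)
Lemma resolvent_two_steps lam mu x y : 0 < mu -> mu <= lam ->
  d (J lam x) (J mu y) ^+ 2 <=
  (1 - mu / lam) * d (J lam x) y ^+ 2 + mu / lam * d x y ^+ 2.
Proof.
move=> mu0 mulam; have lam0 := lt_le_trans mu0 mulam.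
set t := mu / lam; have t0 : 0 < t by rewrite divr_gt0.
have t1 : t <= 1 by rewrite ler_pdivrMr// mul1r.
have tl : t * lam = mu by rewrite /t divfK// gt_eqF.
set w := J lam x.
have t01 : 0 <= t <= 1 by rewrite ltW.
have [z [wz zx hz _]] := geodesic_point hadH w x t01.
have [dw hw] := Jvar x lam0.
have wE : w = J mu z.
  apply: resolvent_unique => // v dv.
  have h1 : 2 * lam * (phi w - phi v) + d x w ^+ 2 <= d x v ^+ 2.
    by apply: le_trans (hw v dv); rewrite lerDl sqr_ge0.
  rewrite (metric_sym z w) wz (metric_sym w x) -tl.
  have tri := metric_triangle x z v.
  move: zx; rewrite (metric_sym z x) (metric_sym w x) => zx.
  have h2 : d x v ^+ 2 <= ((1 - t) * d x w + d z v) ^+ 2.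
    rewrite lerXn2r// ?nnegrE ?mdist_ge0//; last by rewrite -zx.
    by rewrite -zx addr_ge0// mdist_ge0.
  (* Once [h1] and [h2] are combined, the slack is [1 - t] times this square. *)
  have h3 := sqr_ge0 (t * d x w - d z v).
  have t1' : 0 <= 1 - t by rewrite subr_ge0.
  have := ler_wpM2l t1' h3; have := ler_wpM2l (ltW t0) h1.
  have := ler_wpM2l (ltW t0) h2; lra.
have h1 := resolvent_nonexpansive z y mu0.
apply: (@le_trans _ _ (d z y ^+ 2)).
  rewrite wE; by rewrite lerXn2r// nnegrE mdist_ge0.
have := hz y; rewrite (metric_sym y z) (metric_sym y w) (metric_sym y x).
have : 0 <= t * (1 - t) * d w x ^+ 2.
  by rewrite mulr_ge0 ?sqr_ge0// mulr_ge0 ?subr_ge0// ltW.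
lra.
Qed.

Lemma dist_iter_resolvent lam y (L : R) k : 0 < lam ->
  d y (J lam y) <= lam * L -> d y (iter k (J lam) y) <= k%:R * lam * L.
Proof.
move=> lam0 h; elim: k => [|k IH]; first by rewrite !mul0r mdistxx.
rewrite iterS (le_trans (metric_triangle _ (J lam y) _))//.
have := resolvent_nonexpansive y (iter k (J lam) y) lam0.
rewrite -natr1; lra.
Qed.

(* The recursion given by [resolvent_two_steps] is solved by
   (m lam - n mu)^2 + m lam^2 + n mu^2, up to the factor L^2. *)
Lemma dist_iter_resolvents lam mu y (L : R) m n :
  (forall s, 0 < s -> d y (J s y) <= s * L) -> 0 < mu -> mu <= lam ->
  d (iter m (J lam) y) (iter n (J mu) y) ^+ 2 <=
  L ^+ 2 * ((m%:R * lam - n%:R * mu) ^+ 2 + m%:R * lam ^+ 2 + n%:R * mu ^+ 2).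
Proof.
move=> hL mu0 mulam; have lam0 := lt_le_trans mu0 mulam.
have L0 : 0 <= L.
  by rewrite -(pmulr_rge0 L mu0); apply: le_trans (hL _ mu0); exact: mdist_ge0.
have edge s k : 0 < s -> d y (iter k (J s) y) ^+ 2 <=
    L ^+ 2 * ((k%:R * s) ^+ 2 + k%:R * s ^+ 2).
  move=> s0; have h := dist_iter_resolvent k s0 (hL s s0).
  have : d y (iter k (J s) y) ^+ 2 <= (k%:R * s * L) ^+ 2.
    by rewrite lerXn2r// nnegrE ?mdist_ge0//; apply: le_trans h; exact: mdist_ge0.
  have : 0 <= L ^+ 2 * (k%:R * s ^+ 2) by rewrite mulr_ge0 ?sqr_ge0// mulr_ge0 ?sqr_ge0.
  lra.
elim: n m => [|n IH] [|m].
- by rewrite mdistxx !mul0r subrr !addr0 !expr0n mulr0.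
- have := edge lam m.+1 lam0; rewrite metric_sym /=; lra.
- have := edge mu n.+1 mu0; rewrite /=; lra.
rewrite !iterS; apply: le_trans (resolvent_two_steps _ _ mu0 mulam) _.
set t := mu / lam.
have t0 : 0 <= t by rewrite divr_ge0// ltW.
have t1 : 0 <= 1 - t by rewrite subr_ge0 ler_pdivrMr// mul1r.
have tl : t * lam = mu by rewrite /t divfK// gt_eqF.
have := ler_wpM2l t1 (IH m.+1); have := ler_wpM2l t0 (IH m).
rewrite iterS -!natr1.
(* The claimed bound exceeds what the recursion yields by [2 L^2 mu^2]. *)
have : 0 <= L ^+ 2 * mu ^+ 2 by rewrite mulr_ge0 ?sqr_ge0.
rewrite -tl; lra.
Qed.

(** This provides the hypothesis of [dist_iter_resolvents] at [J lam x]. Weighting the two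
    variational inequalities by [mu] and [lam] cancels the values of [f]. *)
Lemma dist_resolvent_resolvent lam mu x : 0 < lam -> 0 < mu ->
  d (J lam x) (J mu (J lam x)) <= mu * (d x (J lam x) / lam).
Proof.
move=> lam0 mu0; set y := J lam x; set w := J mu y.
have [->|ne] := eqVneq y w.
  by rewrite mdistxx; apply: mulr_ge0 (ltW mu0) (divr_ge0 (mdist_ge0 _ _) (ltW lam0)).
have [dy hy] := Jvar x lam0; have [dw hw] := Jvar y mu0.
have := hy _ dw; have := hw _ dy; rewrite mdistxx -/w -/y (metric_sym w y).
have tri := metric_triangle x y w.
have tri2 : d x w ^+ 2 <= (d x y + d y w) ^+ 2.
  by rewrite lerXn2r// nnegrE ?addr_ge0// mdist_ge0.
move: ne; rewrite -mdist_gt0 => D0 h1 h2.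
rewrite mulrA ler_pdivlMr// -(ler_pM2l D0).
have := ler_wpM2l (ltW lam0) h1; have := ler_wpM2l (ltW mu0) h2.
have := ler_wpM2l (ltW mu0) tri2; lra.
Qed.

(** Both iterations cover the same total time [t], so the squared difference in
    [dist_iter_resolvents] vanishes and [t^2 (1/k + 1/m)] remains. The bound involves [f] only
    through [r]. *)
Lemma dist_iter_resolvent_steps lam t x k m (r e : R) :
  0 < lam -> 0 < t -> (0 < k)%N -> (k <= m)%N ->
  d x (J lam x) <= r -> 0 <= e -> (r / lam) ^+ 2 * t ^+ 2 * (2 / k%:R) <= e ^+ 2 ->
  d (iter k (J (t / k%:R)) (J lam x)) (iter m (J (t / m%:R)) (J lam x)) <= e.
Proof.
move=> lam0 t0 k0 km hr e0 he.
have m0 := leq_trans k0 km.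
have k0' : 0 < k%:R :> R by rewrite ltr0n.
have m0' : 0 < m%:R :> R by rewrite ltr0n.
have mk : (m%:R)^-1 <= (k%:R)^-1 :> R by rewrite lef_pV2// ler_nat.
rewrite -(@ler_pXn2r _ 2)// ?nnegrE ?mdist_ge0//; apply: le_trans he.
have hL s : 0 < s -> d (J lam x) (J s (J lam x)) <= s * (r / lam).
  move=> s0; apply: le_trans (dist_resolvent_resolvent x lam0 s0) _.
  by rewrite ler_pM2l// ler_pM2r// invr_gt0.
have := @dist_iter_resolvents (t / k%:R) (t / m%:R) _ _ k m hL.
rewrite divr_gt0// ler_pM2l// => /(_ isT mk) h; apply: le_trans h _.
rewrite ![_ * (t / _)]mulrC !divfK ?gt_eqF// subrr expr0n add0r -mulrA.
rewrite ler_wpM2l ?sqr_ge0// !expr_div_n.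
have e1 (j : R) : 0 < j -> j * (t ^+ 2 / j ^+ 2) = t ^+ 2 / j.
  by move=> j0; field; rewrite gt_eqF.
rewrite !e1//; have := ler_wpM2l (sqr_ge0 t) mk; lra.
Qed.

(** The variational inequalities weighted by [mu] and [lam] give
    [(lam + mu) D <= (lam - mu) (A - B)], which also forces [B <= A]. *)
Lemma dist_resolvent_param lam mu x : 0 < mu -> mu <= lam ->
  d (J lam x) (J mu x) ^+ 2 <= d x (J lam x) ^+ 2 - d x (J mu x) ^+ 2.
Proof.
move=> mu0; rewrite le_eqVlt => /predU1P[->|mulam].
  by rewrite mdistxx expr0n subrr.
have lam0 := lt_trans mu0 mulam.
have [dl hl] := Jvar x lam0; have [dm hm] := Jvar x mu0.
have := ler_wpM2l (ltW mu0) (hl _ dm); have := ler_wpM2l (ltW lam0) (hm _ dl).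
rewrite (metric_sym (J mu x)).
set A := d x (J lam x) ^+ 2; set B := d x (J mu x) ^+ 2.
set D := d (J lam x) (J mu x) ^+ 2 => h1 h2.
have D0 : 0 <= D by exact: sqr_ge0.
have h : (lam + mu) * D <= (lam - mu) * (A - B) by lra.
have AB : 0 <= A - B.
  have lm0 : 0 < lam - mu by rewrite subr_gt0.
  by rewrite -(pmulr_rge0 _ lm0); apply: le_trans h; rewrite mulr_ge0// addr_ge0// ltW.
have lm0 : 0 < lam + mu by rewrite addr_gt0.
rewrite -(ler_pM2l lm0) (le_trans h)// ler_wpM2r//.
by rewrite lerD2l (le_trans _ (ltW mu0))// oppr_le0 ltW.
Qed.

(** By [dist_resolvent_param], it suffices that [d x (J lam x) ^+ 2] be within [e ^+ 2] of its
    infimum over all parameters. *)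
Lemma resolvent_cauchy_param x (e : R) : 0 < e ->
  exists2 lam, 0 < lam &
    forall mu, 0 < mu -> mu <= lam -> d (J mu x) (J lam x) <= e.
Proof.
move=> e0; pose V := [set d x (J s x) ^+ 2 | s in [set s : R | 0 < s]].
have infV : has_inf V.
  split; first by exists (d x (J 1 x) ^+ 2), 1 => //=.
  by exists 0 => _ [s _ <-]; exact: sqr_ge0.
have e20 : 0 < e ^+ 2 by exact: exprn_gt0.
have [_ [lam /= lam0 <-] h] := inf_adherent e20 infV.
exists lam => // mu mu0 mulam.
have hmu : inf V <= d x (J mu x) ^+ 2.
  by apply: ge_inf; [case: infV | exists mu].
rewrite metric_sym -(@ler_pXn2r _ 2)// ?nnegrE ?mdist_ge0//; last exact: ltW.
have := dist_resolvent_param x mu0 mulam; lra.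
Qed.

End resolvent_theory.

Lemma near_div_natr_le (R : realType) (a e : R) : 0 < e ->
  \forall k \near \oo, a / k%:R <= e.
Proof.
move=> e0; near=> k.
have k0 : 0 < k%:R :> R by rewrite ltr0n; near: k; exact: nbhs_infty_gt.
rewrite ler_pdivrMr// mulrC -ler_pdivrMr//.
by near: k; exact: nbhs_infty_ger.
Unshelve. all: by end_near. Qed.

(** * Convergence of the iterates to the gradient flow *)

Section gradient_flow_theory.
Context (R : realType) (H : metricType R) (hadH : hadamard_space H).
Context (f : H -> \bar R) (f_proper : proper_fun f).
Context (f_lsc : lower_semicontinuous f) (f_convex : geodesically_convex f).
Local Notation d := (@mdist R H).
Local Notation phi := (fun x => fine (f x)).
Local Notation J := (resolvent f).
Implicit Types (x y z : H) (lam mu t : R) (m n k : nat).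

Let Jvar := resolvent_variational hadH f_proper f_lsc f_convex.
Let iterJnonexp := iter_resolvent_nonexpansive hadH f_proper f_lsc f_convex.
Let steps := dist_iter_resolvent_steps hadH f_proper f_lsc f_convex.

(** The variational inequality is tested at a point [z] of the domain near [x], with [phi (J 1 x)]
    as a lower bound for [phi (J lam x)]. *)
Lemma resolvent_approx x (e : R) : closure (edom f) x -> 0 < e ->
  exists2 lam, 0 < lam & d x (J lam x) <= e.
Proof.
move=> clx e0; have e20 : 0 < e / 2 by rewrite divr_gt0.
have [z [dz]] := clx _ (nbhsx_ballx x _ e20); rewrite ballEmdist/= => xz.
have [d1 h1] := Jvar x ltr01.
set A := Num.max 0 (phi z - phi (J 1 x)).
have A0 : 0 <= A by rewrite le_max lexx.
have zA : phi z - phi (J 1 x) <= A by rewrite le_max lexx orbT.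
(* The first bound makes [1 - lam] positive, as [pp] requires; the second makes [2 lam A] at most
   [e^2 / 2]. *)
set lam := Num.min 2^-1 (e ^+ 2 / (4 * (A + 1))).
have A1 : 0 < 4 * (A + 1) by rewrite mulr_gt0// ltr_wpDl.
have lam0 : 0 < lam by rewrite lt_min invr_gt0 ltr0n divr_gt0// exprn_gt0.
have lam1 : lam <= 2^-1 by rewrite ge_min lexx.
have lA : lam * (4 * (A + 1)) <= e ^+ 2.
  by rewrite -ler_pdivlMr// ge_min lexx orbT.
exists lam => //.
have [dl hl] := Jvar x lam0; have h2 := hl _ dz; have h3 := h1 _ dl.
have h4 := hl _ d1.
rewrite -(@ler_pXn2r _ 2)// ?nnegrE ?mdist_ge0//; last exact: ltW.
have xz2 : d x z ^+ 2 <= (e / 2) ^+ 2 by rewrite lerXn2r// ?nnegrE ?mdist_ge0// ltW.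
have s1 := sqr_ge0 (d (J lam x) z).
have s2 := sqr_ge0 (d (J 1 x) (J lam x)).
have s3 := sqr_ge0 (d (J lam x) (J 1 x)).
have pp : phi (J 1 x) <= phi (J lam x).
  have l1 : 0 < 1 - lam by lra.
  rewrite -(ler_pM2l l1); lra.
have lz := ler_wpM2l (ltW lam0) zA.
have lp := ler_wpM2l (ltW lam0) pp.
have := sqr_ge0 e; lra.
Qed.

(** The iterates from [x] are shown to be Cauchy by comparison with those from [J lam x], whose rate
    of convergence is known. *)
Lemma gradient_flow_cvg t x : 0 < t ->
  iter k (J (t / k%:R)) x @[k --> \oo] --> gradient_flow f t x.
Proof.
move=> t0.
apply: (@xgetPex _ x [set l | iter k (J (t / k%:R)) x @[k --> \oo] --> l]).
case: hadH => complH _ _; apply: complH; apply: cauchy_exP => e e0.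
have e5 : 0 < e / 5 by rewrite divr_gt0.
have [lam lam0 hlam] := resolvent_cauchy_param hadH f_proper f_lsc f_convex x e5.
set y := J lam x; set L := d x y / lam.
have L0 : 0 <= L by rewrite divr_ge0 ?mdist_ge0// ltW.
have close k : (0 < k)%N -> t / k%:R <= lam -> t * L / k%:R <= e / 5 ->
    d (iter k (J (t / k%:R)) x) (iter k (J (t / k%:R)) y) <= e / 5 + e / 5.
  move=> k0 h1 h2.
  have s0 : 0 < t / k%:R by rewrite divr_gt0// ltr0n.
  case: k k0 s0 h1 h2 => // k _; set s := t / _ => s0 h1 h2.
  (* As [x] may be far from [y], one step is split off first: [J s x] is close to [y] by the choice
     of [lam], and so is [J s y]. *)
  rewrite iterSr [iter _ _ y]iterS -iterS [iter _ _ y]iterSr.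
  apply: le_trans (iterJnonexp _ _ _ s0) _.
  apply: le_trans (metric_triangle _ y _) _; apply: lerD; first exact: hlam.
  apply: le_trans (dist_resolvent_resolvent hadH f_proper f_lsc f_convex x lam0 s0) _.
  by apply: le_trans h2; rewrite /s mulrAC.
have near_close : \forall k \near \oo,
   [/\ (0 < k)%N, t / k%:R <= lam, t * L / k%:R <= e / 5 &
    (* The final sum [2e/5 + e/6 + 2e/5] stays strictly below [e]. *)
    L ^+ 2 * t ^+ 2 * (2 / k%:R) <= (e / 6) ^+ 2].
  near=> k; split.
  - by near: k; exact: nbhs_infty_gt.
  - by near: k; exact: near_div_natr_le.
  - by near: k; exact: near_div_natr_le.
  - rewrite mulrA; near: k; apply: near_div_natr_le.
    by rewrite exprn_gt0// divr_gt0.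
have [K _ hK] := near_close.
have [K0 K1 K2 K3] := hK K (leqnn K).
exists (iter K (J (t / K%:R)) x), K => // m /= Km.
have [m0 m1 m2 _] := hK m Km.
rewrite ballEmdist/=.
have c1 := close K K0 K1 K2; have := close m m0 m1 m2; rewrite metric_sym => c2.
have e6 : 0 <= e / 6 by rewrite divr_ge0// ltW.
have c3 := steps lam0 t0 K0 Km (lexx _) e6 K3.
have t1 := metric_triangle (iter K (J (t / K%:R)) x)
  (iter K (J (t / K%:R)) y) (iter m (J (t / m%:R)) x).
have t2 := metric_triangle (iter K (J (t / K%:R)) y)
  (iter m (J (t / m%:R)) y) (iter m (J (t / m%:R)) x).
move: c3; rewrite -/y; lra.
Unshelve. all: by end_near. Qed.

(** The term [r] pays for starting at [J lam x] instead of [x], and [e] for stopping at [k] steps;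
    neither depends otherwise on [f]. *)
Lemma dist_gradient_flow_iter lam t x k (r e : R) :
  0 < lam -> 0 < t -> (0 < k)%N -> d x (J lam x) <= r -> 0 <= e ->
  (r / lam) ^+ 2 * t ^+ 2 * (2 / k%:R) <= e ^+ 2 ->
  d (gradient_flow f t x) (iter k (J (t / k%:R)) (J lam x)) <= r + e.
Proof.
move=> lam0 t0 k0 hr e0 he; apply/ler_addgt0Pr => s s0.
have lim : \forall m \near \oo,
    d (gradient_flow f t x) (iter m (J (t / m%:R)) x) < s.
  exact: (metricType_numDomainType.cvgr_dist_lt (@gradient_flow_cvg _ x t0) s0).
have [m [h1 km]] := filter_ex (filterI lim (nbhs_infty_ge k)).
have tm0 : 0 < t / m%:R by rewrite divr_gt0// ltr0n (leq_trans k0).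
have h2 := iterJnonexp x (J lam x) m tm0.
have := steps lam0 t0 k0 km hr e0 he; rewrite metric_sym => h3.
have t1 := metric_triangle (gradient_flow f t x) (iter m (J (t / m%:R)) x)
  (iter k (J (t / k%:R)) (J lam x)).
have t2 := metric_triangle (iter m (J (t / m%:R)) x)
  (iter m (J (t / m%:R)) (J lam x)) (iter k (J (t / k%:R)) (J lam x)).
lra.
Qed.

End gradient_flow_theory.

(** * Passage to the limit in the sequence of functions *)

Unset Implicit Arguments.

Theorem theorem4p4 (R : realType) (H : metricType R)
  (f : H -> \bar R) (fn : nat -> H -> \bar R)
  (hadH : hadamard_space H)
  (f_proper : proper_fun f)
  (f_lsc : lower_semicontinuous f)
  (f_convex : geodesically_convex f)
  (fn_proper : forall n, proper_fun (fn n))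
  (fn_lsc : forall n, lower_semicontinuous (fn n))
  (fn_convex : forall n, geodesically_convex (fn n))
  (resolvent_cvg : forall (x : H) (lam : R), closure (edom f) x -> 0 < lam ->
    resolvent (fn n) lam x @[n --> \oo] --> resolvent f lam x) :
  forall (x : H) (t : R), closure (edom f) x -> 0 < t ->
    gradient_flow (fn n) t x @[n --> \oo] --> gradient_flow f t x.
Proof.
have Jcl y lam : 0 < lam -> closure (edom f) (resolvent f lam y).
  by move=> lam0; apply: subset_closure; exact: edom_resolvent.
move=> x t clx t0; apply/metricType_numDomainType.cvgrPdist_le => e e0.
have e8 : 0 < e / 8 by rewrite divr_gt0.
have [lam lam0 hlam] := resolvent_approx hadH f_proper f_lsc f_convex clx e8.
set y := resolvent f lam x.
(* For large [n], [r] bounds the distance from [x] to both [J_lam x] and [J^n_lam x]. Each flow then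
   costs [3e/8], and the two comparisons of iterates [e/8] each. *)
set r := 2 * (e / 8).
have r0 : 0 < r by rewrite mulr_gt0.
have e82 : 0 < (e / 8) ^+ 2 by exact: exprn_gt0.
(* This [k] is fixed before [n] and serves [f] and every [fn n] alike. *)
have [k [hk k0]] := filter_ex (filterI
  (near_div_natr_le ((r / lam) ^+ 2 * t ^+ 2 * 2) e82) (nbhs_infty_gt 0)).
rewrite -(mulrA _ 2) in hk.
have s0 : 0 < t / k%:R by rewrite divr_gt0// ltr0n.
set s := t / k%:R in s0.
(* The closure is carried along because [resolvent_cvg] applies only there. The iterates for [fn n]
   may leave it, so the new resolvent is compared at the limit iterate and nonexpansiveness absorbs
   the rest. *)
have iter_cvg j : closure (edom f) (iter j (resolvent f s) y) /\
    iter j (resolvent (fn n) s) y @[n --> \oo] --> iter j (resolvent f s) y.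
  elim: j => [|j [clj IH]]; first by split; [exact: (Jcl x lam) | exact: cvg_cst].
  split; first exact: (Jcl _ s).
  apply/metricType_numDomainType.cvgrPdist_le => c c0.
  have c2 : 0 < c / 2 by rewrite divr_gt0.
  have N1 := metricType_numDomainType.cvgr_dist_le IH c2.
  have N2 := metricType_numDomainType.cvgr_dist_le (resolvent_cvg _ _ clj s0) c2.
  near=> n; rewrite !iterS.
  apply: le_trans (metric_triangle _ (resolvent (fn n) s (iter j (resolvent f s) y)) _) _.
  rewrite [leRHS]splitr; apply: lerD; first by near: n; exact: N2.
  apply: le_trans (resolvent_nonexpansive hadH (fn_proper n) (fn_lsc n)
    (fn_convex n) _ _ s0) _.
  by near: n; exact: N1.
have N1 := metricType_numDomainType.cvgr_dist_le (resolvent_cvg _ _ clx lam0) e8.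
have N2 := metricType_numDomainType.cvgr_dist_le (iter_cvg k).2 e8.
near=> n.
have h1 : mdist y (resolvent (fn n) lam x) <= e / 8 by near: n; exact: N1.
have h2 : mdist (iter k (resolvent f s) y) (iter k (resolvent (fn n) s) y) <= e / 8.
  by near: n; exact: N2.
have xyn : mdist x (resolvent (fn n) lam x) <= r.
  by have := metric_triangle x y (resolvent (fn n) lam x); rewrite /r -/y in hlam *; lra.
have h3 := dist_gradient_flow_iter hadH (fn_proper n) (fn_lsc n) (fn_convex n)
  lam0 t0 k0 xyn (ltW e8) hk.
have xyr : mdist x (resolvent f lam x) <= r by rewrite /r; lra.
have h4 := dist_gradient_flow_iter hadH f_proper f_lsc f_convex
  lam0 t0 k0 xyr (ltW e8) hk.
have h5 := iter_resolvent_nonexpansive hadH (fn_proper n) (fn_lsc n)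
  (fn_convex n) y (resolvent (fn n) lam x) k s0.
move: h3 h4; rewrite -/s -/y metric_sym => h3 h4.
have t1 := metric_triangle (gradient_flow f t x) (iter k (resolvent f s) y)
  (gradient_flow (fn n) t x).
have t2 := metric_triangle (iter k (resolvent f s) y)
  (iter k (resolvent (fn n) s) y) (gradient_flow (fn n) t x).
have t3 := metric_triangle (iter k (resolvent (fn n) s) y)
  (iter k (resolvent (fn n) s) (resolvent (fn n) lam x))
  (gradient_flow (fn n) t x).
rewrite /r in h3 h4; lra.
Unshelve. all: by end_near. Qed.
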